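(* Let $n\geq 1$ and $m\geq 3$ be integers. The number of permutations $\pi\in\mathfrak{S}_n$ that avoid $12\cdots m$ as a consecutive pattern and satisfy $\operatorname{ipk}(\pi)=0$ (that is, such that $\pi^{-1}$ has no peaks) is equal to $f_n^{(m-1)}$.
   Context: $\mathfrak{S}_n$ is the set of permutations of $[n]=\{1,2,\dots,n\}$, written in one-line notation $\pi=\pi_1\pi_2\cdots\pi_n$. For a sequence $w$ of $n$ distinct integers, the standardization $\operatorname{std}(w)\in\mathfrak{S}_n$ is obtained by replacing the smallest entry of $w$ with $1$, the second smallest with $2$, and so on. A permutation $\pi\in\mathfrak{S}_n$ contains $\sigma\in\mathfrak{S}_m$ as a consecutive pattern if $\operatorname{std}(\pi_i\pi_{i+1}\cdots\pi_{i+m-1})=\sigma$ for some $i\in[n-m+1]$; otherwise $\pi$ avoids $\sigma$ as a consecutive pattern (in particular $\pi$ avoids $\sigma$ whenever $n<m$). Here $12\cdots m$ is the identity permutation in $\mathfrak{S}_m$. An index $i\in\{2,3,\dots,n-1\}$ is a peak of $\pi\in\mathfrak{S}_n$ if $\pi_{i-1}<\pi_i>\pi_{i+1}$. $\operatorname{ipk}(\pi)$ denotes the number of peaks of the inverse permutation $\pi^{-1}$. The Fibonacci sequence of order $k$, $\{f_n^{(k)}\}_{n\geq 0}$, is defined by $f_0^{(k)}=1$ and $f_n^{(k)}=f_{n-1}^{(k)}+f_{n-2}^{(k)}+\cdots+f_{n-k}^{(k)}$ for $n\geq 1$, where $f_n^{(k)}$ is treated as $0$ for $n<0$. *)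

(* Defs.v *)
From mathcomp Require Import all_boot all_fingroup.

Set Implicit Arguments.
Unset Strict Implicit.
Unset Printing Implicit Defensive.

(* ['S_n] permutes {0, ..., n-1}; the word has letters 1, ..., n. *)
Definition oneline n (p : 'S_n) : seq nat := [seq (p i).+1 | i <- enum 'I_n].

(* The intended w have distinct entries; the result then has letters 1..size w. *)
Definition std (w : seq nat) : seq nat :=
  [seq count (fun y => y <= x) w | x <- w].

(* The position i is 0-based, so the range 1..n-m+1 becomes i + m <= n. *)
Definition contains_consecutive n m (p : 'S_n) (s : 'S_m) : bool :=
  [exists i : 'I_n.+1,
    (i + m <= n) && (std (take m (drop i (oneline p))) == oneline s)].

Definition avoids_consecutive n m (p : 'S_n) (s : 'S_m) : bool :=
  ~~ contains_consecutive p s.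

(* [i] is the usual 1-based index, whereas [nth] is 0-based. *)
Definition is_peak n (p : 'S_n) (i : nat) : bool :=
  let a j := nth 0 (oneline p) j.-1 in
  [&& 2 <= i, i <= n.-1, a i.-1 < a i & a i > a i.+1].

Definition pk n (p : 'S_n) : nat := #|[set i : 'I_n | is_peak p i]|.

Definition ipk n (p : 'S_n) : nat := pk (p^-1)%g.

(* [:: f_n; ...; f_0] for the Fibonacci sequence of order k; [take] drops the
   terms of negative index. *)
Fixpoint kfib_rev (k n : nat) : seq nat :=
  if n is n'.+1 then
    let s := kfib_rev k n' in sumn (take k s) :: s
  else [:: 1].

Definition kfib (k n : nat) : nat := head 0 (kfib_rev k n).

Lemma kfib0 k : kfib k 0 = 1.
Proof. by []. Qed.

Lemma size_kfib_rev k n : size (kfib_rev k n) = n.+1.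
Proof. by elim: n => //= n ->. Qed.

Lemma nth_kfib_rev k n j : j <= n -> nth 0 (kfib_rev k n) j = kfib k (n - j).
Proof.
elim: n j => [|n IHn] [|j] //= le_jn.
by rewrite IHn // subSS.
Qed.

Lemma kfib_rec k n : 0 < n ->
  kfib k n = \sum_(1 <= j < k.+1 | j <= n) kfib k (n - j).
Proof.
case: n => // n _; rewrite {1}/kfib /= sumnE (big_nth 0).
rewrite big_add1 /= size_take size_kfib_rev.
transitivity (\sum_(0 <= i < minn k n.+1) kfib k (n - i)).
  rewrite -/(minn _ _) !big_nat; apply: eq_bigr => i.
  rewrite leq_min => /andP[_ /andP[lt_ik lt_in]].
  by rewrite nth_take // nth_kfib_rev.
rewrite !big_mkord; under [RHS]eq_bigr do rewrite subSS.
rewrite (big_ord_widen_cond k xpredT (fun i => kfib k (n - i))) ?geq_minl //.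
by apply: eq_bigl => i; rewrite /= leq_min ltn_ord.
Qed.

(* Main.v *)
Require Import Defs.
From mathcomp Require Import all_boot all_fingroup.
From mathcomp Require Import order zify.

(** The inverse of [p] has no peak exactly when its one-line word is a valley:
    it decreases down to its minimum and increases afterwards.  Reading this
    in [p], call a letter low if it is at most the first letter of [p]; then
    the low letters appear in decreasing order, the other letters in
    increasing order, and the first letter is low.  So [p] is a shuffle of
    these two sequences and is determined by the positions of its low letters;
    every set of positions that contains the first one arises.  For size [n.+1]
    this gives a bijection [word] with Boolean words of length [n], which
    record, from the second position on, whether the letter is low
    ([realizes_inj], [realizable], [ipk0_realizes], [realizes_ipk0]).

    A position of such a [p] is an ascent exactly when the next letter is not
    low: a low letter is below everything to its left, and a high letter above
    everything to its left.  A consecutive pattern 12...m is a run of [m - 1]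
    ascents, hence a run of [m - 1] letters [false] in the word
    ([realizes_avoids]).

    It remains to count Boolean words without [k] consecutive letters [false].
    Their count satisfies the recurrence of the Fibonacci numbers of order [k]:
    the position of the first [true] takes [k] possible values, and the word
    after it is an arbitrary shorter word of the same kind; the word without
    [true], if short enough, accounts for the term [f_0 = 1] ([card_words]). *)

Set Implicit Arguments.
Unset Strict Implicit.
Unset Printing Implicit Defensive.

(** * Consecutive occurrences of an increasing pattern *)

Lemma nth_oneline n (p : 'S_n) i (lt_in : i < n) :
  nth 0 (oneline p) i = (p (Ordinal lt_in)).+1.
Proof.
rewrite (nth_map (Ordinal lt_in)) ?size_enum_ord //.
by congr (p _).+1; apply: val_inj; rewrite /= nth_enum_ord.
Qed.

Lemma size_oneline n (p : 'S_n) : size (oneline p) = n.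
Proof. by rewrite size_map size_enum_ord. Qed.

Lemma oneline1 n : oneline (1%g : 'S_n) = iota 1 n.
Proof.
rewrite -(addn0 1) iotaDl -val_enum_ord -map_comp.
by apply: eq_map => i; rewrite perm1.
Qed.

(** A weak descent would make the rank of a letter at least that of the next
    one, whereas the ranks are 1, 2, ... in this order; conversely, in an
    increasing word the smaller letters are exactly those further left. *)
Lemma std_eq_iota w : (std w == iota 1 (size w)) = sorted ltn w.
Proof.
apply/eqP/idP => [std_w | w_sorted]; last first.
  apply: (@eq_from_nth _ 0); rewrite size_map ?size_iota // => i lt_iw.
  rewrite (nth_map 0) // nth_iota // add1n.
  exact: (Order.PreorderTheory.count_le_nth 0 w_sorted lt_iw).
apply/(sortedP 0) => i lt_i1w; rewrite /= ltnNge; apply/negP => le_nth.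
have rank j : j < size w ->
    count (fun y => y <= nth 0 w j) w = j.+1.
  move=> lt_jw; have := congr1 (fun s => nth 0 s j) std_w.
  by rewrite (nth_map 0) // nth_iota // add1n.
have : count (fun y => y <= nth 0 w i.+1) w
       <= count (fun y => y <= nth 0 w i) w.
  by apply: sub_count => y /= /leq_trans; apply.
by rewrite !rank ?ltnn // ltnW.
Qed.

Lemma contains_identityP n m (p : 'S_n) :
  reflect (exists2 i, i + m <= n &
             forall j, i <= j -> j.+1 < i + m ->
               nth 0 (oneline p) j < nth 0 (oneline p) j.+1)
          (contains_consecutive p (1%g : 'S_m)).
Proof.
have window i : i + m <= n ->
    (std (take m (drop i (oneline p))) == oneline (1%g : 'S_m))
    = sorted ltn (take m (drop i (oneline p))).
  move=> le_imn; rewrite -std_eq_iota oneline1.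
  by rewrite size_takel // size_drop size_oneline; lia.
apply: (iffP existsP) => [[i /andP[le_imn]] | [i le_imn asc]].
  rewrite window // => /(sortedP 0) asc.
  exists i => // j le_ij lt_j; have := asc (j - i).
  rewrite size_takel ?size_drop ?size_oneline; last by lia.
  rewrite !nth_take ?nth_drop; try lia.
  by rewrite addnS subnKC //; apply; lia.
have lt_in : i < n.+1 by lia.
exists (Ordinal lt_in); rewrite /= le_imn window //.
apply/(sortedP 0) => j; rewrite size_takel ?size_drop ?size_oneline;
  last by lia.
move=> lt_jm; rewrite !nth_take ?nth_drop; try lia.
by rewrite /= addnS asc //; lia.
Qed.

Lemma infix_nseqP (T : eqType) (x0 b : T) k (s : seq T) :
  reflect (exists2 i, i + k <= size s &
             forall j, i <= j < i + k -> nth x0 s j = b)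
          (infix (nseq k b) s).
Proof.
apply: (iffP (@infixP _ _ _)) => [[s1 [s2 ->]] | [i le_iks nth_s]].
  exists (size s1) => [|j /andP[le_j lt_j]].
    by rewrite !size_cat size_nseq; lia.
  rewrite nth_cat ltnNge le_j /= nth_cat size_nseq nth_nseq.
  by have -> : j - size s1 < k by lia.
exists (take i s), (drop (i + k) s).
rewrite -[LHS](cat_take_drop i); congr (_ ++ _).
rewrite addnC -drop_drop -[LHS](cat_take_drop k); congr (_ ++ _).
apply: (@eq_from_nth _ x0); rewrite size_takel ?size_drop ?size_nseq //;
  try lia.
by move=> j lt_jk; rewrite nth_take // nth_drop nth_nseq lt_jk nth_s //; lia.
Qed.

(** * Permutations whose inverse has no peak *)

(** Having no peak is stated as persistence of ascents, which is the form in
    which it propagates along the word.  Since the entries are distinct, weak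
    inequalities can be used throughout. *)
Lemma ipk0P n (p : 'S_n) (a := nth 0 (oneline (p^-1)%g)) :
  reflect (forall i, i.+2 < n -> a i <= a i.+1 -> a i.+1 <= a i.+2)
          (ipk p == 0).
Proof.
have a_neq i j : i < n -> j < n -> i != j -> a i != a j.
  move=> lt_in lt_jn; apply: contra_neq; rewrite /a !nth_oneline => -[].
  by move/val_inj/perm_inj => -[].
rewrite /ipk /pk cards_eq0; apply: (iffP eqP) => [peak0 i lt_in le_a | no_peak].
  rewrite leqNgt; apply/negP => gt_a.
  (* [is_peak] is 1-based: index [i.+2] compares positions [i], [i.+1], [i.+2]. *)
  have /setP/(_ (Ordinal lt_in)) := peak0; rewrite !inE /is_peak /=.
  by rewrite -!/(a _) gt_a (ltn_neqAle (a i)) le_a a_neq //; lia.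
apply/setP => i; rewrite !inE; apply/negP; rewrite /is_peak.
case: i => -[|[|i]] //= lt_in /and3P[le_in /ltnW lt_a].
by rewrite ltnNge no_peak //; lia.
Qed.

Section Valley.
Variables (a : nat -> nat) (n : nat).
Hypothesis no_peak : forall i, i.+2 < n -> a i <= a i.+1 -> a i.+1 <= a i.+2.

Lemma ascent_persists i j : a i <= a i.+1 -> i < j < n -> a i.+1 <= a j.
Proof.
move=> asc_i /andP[lt_ij lt_jn].
suff [//] : a i.+1 <= a j /\ a j.-1 <= a j.
elim: j lt_ij lt_jn => // j IHj.
rewrite leq_eqVlt => /predU1P[[<-] // | lt_ij] lt_jn.
have [le_a asc_j] := IHj lt_ij (ltnW lt_jn).
have {}asc_j : a j <= a j.+1.
  by case: j {IHj le_a} lt_ij lt_jn asc_j => // j _; apply: no_peak.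
by split=> //; apply: leq_trans asc_j.
Qed.

Variable k : nat.
Hypotheses (lt_kn : k < n) (min_k : forall i, i < n -> a k <= a i).

Lemma valley_increasing i j : k <= i -> i <= j < n -> a i <= a j.
Proof.
move=> le_ki /andP[]; rewrite leq_eqVlt => /predU1P[-> // | lt_ij] lt_jn.
suff asc_i : a i <= a i.+1 by rewrite (leq_trans asc_i) ?ascent_persists ?lt_ij.
elim: i le_ki lt_ij => [|i IHi].
  by rewrite leqn0 => /eqP <- lt0j; apply: min_k; lia.
rewrite leq_eqVlt => /predU1P[<- lt_kj | le_ki lt_ij].
  by apply: min_k; lia.
by apply: no_peak; [lia | apply: IHi => //; lia].
Qed.

(** Before its minimum [a k] the sequence cannot ascend: the ascent would
    persist up to [k] and leave [a k] above an earlier value. *)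
Lemma valley_decreasing i j : i <= j <= k -> a j <= a i.
Proof.
case/andP; elim: j => [|j IHj]; first by rewrite leqn0 => /eqP ->.
rewrite leq_eqVlt => /predU1P[-> // | le_ij] lt_jk.
apply: leq_trans (IHj le_ij (ltnW lt_jk)).
rewrite leqNgt; apply/negP => asc_j.
have := ascent_persists (ltnW asc_j); move/(_ k); rewrite lt_jk lt_kn.
move=> /(_ isT) le_jk; have := min_k (ltn_trans lt_jk lt_kn).
by move/(leq_trans le_jk); rewrite leqNgt asc_j.
Qed.

End Valley.

(** * Permutations as shuffles *)

(** The letter [true] put in front of [w] expresses that the first letter of
    the permutation is always low. *)
Definition low (w : seq bool) x := nth true (true :: w) x.

(** The order of the letters at positions [y] and [x] in the shuffle: low
    letters are below high ones, low letters decrease along the positions and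
    high letters increase. *)
Definition precedes (w : seq bool) y x :=
  if low w x then low w y && (x < y) else low w y || (y < x).

Definition realizes n (w : seq bool) (p : 'S_n) :=
  forall x y : 'I_n, (p y < p x) = precedes w y x.

(** A permutation is determined by the relative order of its letters, since
    each letter is the number of smaller ones. *)
Lemma realizes_inj n w (p q : 'S_n) : realizes w p -> realizes w q -> p = q.
Proof.
have rank (r : 'S_n) (x : 'I_n) : #|[set y | r y < r x]| = r x.
  have -> : [set y | r y < r x] = r @^-1: [set z : 'I_n | z < r x].
    by apply/setP => y; rewrite !inE.
  rewrite card_preimset; last exact: perm_inj.
  rewrite -[RHS](card_ord (r x)) -sum1dep_card.
  by rewrite -(big_ord_widen _ (fun _ => 1)) ?sum1_card // ltnW.
move=> p_w q_w; apply/permP => x; apply: val_inj.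
rewrite /= -[LHS]rank -[RHS]rank; apply: eq_card => y.
by rewrite !inE p_w q_w.
Qed.

(** [precedes w] is a strict total order, so ranking the positions by it gives a
    permutation. *)
Lemma realizable n w : exists p : 'S_n, realizes w p.
Proof.
have irr x : precedes w x x = false.
  by rewrite /precedes ltnn andbF orbF; case: low.
have trans : transitive (precedes w).
  move=> y x z; rewrite /precedes.
  by case: (low w x) (low w y) (low w z) => [] [] [] //=; lia.
have tot x y : x != y -> precedes w x y || precedes w y x.
  by rewrite /precedes; case: (low w x) (low w y) => [] [] //=; lia.
pose below (x : 'I_n) := [set y : 'I_n | precedes w y x].
have rank_lt x : #|below x| < n.
  rewrite -[X in _ < X](card_ord n) -cardsT; apply: proper_card.
  by apply/properP; split; [exact: subsetT | exists x; rewrite !inE ?irr].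
have rank_mono (x y : 'I_n) : precedes w y x -> #|below y| < #|below x|.
  move=> lt_yx; apply: proper_card; apply/properP; split; last first.
    by exists y; rewrite !inE ?irr.
  by apply/subsetP => z; rewrite !inE => /trans; apply.
pose rank x := Ordinal (rank_lt x).
have rank_inj : injective rank.
  move=> x y /(congr1 val) /= eq_rank; apply: val_inj; apply/eqP/negPn/negP.
  by move/tot => /orP[] /rank_mono; rewrite eq_rank ltnn.
exists (perm rank_inj) => x y; rewrite !permE /=.
apply/idP/idP => [lt_yx | /rank_mono //].
have [eq_xy | /tot/orP[/rank_mono|//]] := eqVneq (x : nat) y.
  by move: lt_yx; rewrite (val_inj eq_xy) ltnn.
by rewrite ltnNge ltnW.
Qed.

Section Word.
Variable n : nat.
Implicit Types (p : 'S_n.+1) (w : n.-tuple bool).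

Definition word p : n.-tuple bool := [tuple p (lift ord0 j) <= p ord0 | j < n].

Lemma low_word p (x : 'I_n.+1) : low (word p) x = (p x <= p ord0).
Proof.
case: (unliftP ord0 x) => [j|] ->; last by rewrite leqnn.
by rewrite /low lift0 /= (nth_map j) ?size_enum_ord // nth_ord_enum.
Qed.

Lemma word_realizes w p : realizes w p -> word p = w.
Proof.
move=> p_w; apply: eq_from_tnth => j; rewrite tnth_mktuple leqNgt p_w.
by rewrite (tnth_nth true) /precedes /low /= ltn0; case: nth.
Qed.

(** The inverse is a valley with minimum at index [p ord0], the index at which
    it takes the first position.  The low letters are thus the indices of the
    decreasing branch, and the high ones those of the increasing branch. *)
Lemma ipk0_realizes p : ipk p == 0 -> realizes (word p) p.
Proof.
set a := nth 0 (oneline (p^-1)%g) => /ipk0P no_peak.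
have a_p (x : 'I_n.+1) : a (p x) = x.+1.
  rewrite /a nth_oneline; congr (_.+1).
  by rewrite (_ : Ordinal _ = p x) ?permK //; apply: val_inj.
have lt_kn : p ord0 < n.+1 by [].
have min_k i : i < n.+1 -> a (p ord0) <= a i.
  by move=> lt_in; rewrite a_p /a nth_oneline.
have incr := @valley_increasing a _ no_peak _ lt_kn min_k.
have decr := @valley_decreasing a _ no_peak _ lt_kn min_k.
move=> x y; rewrite /precedes !low_word.
have p_eq : (p x == p y :> nat) = (x == y :> nat).
  by rewrite !val_eqE (inj_eq perm_inj).
have ltx := ltn_ord (p x); have lty := ltn_ord (p y).
have := incr (p x) (p y); have := incr (p y) (p x).
have := decr (p x) (p y); have := decr (p y) (p x); rewrite !a_p !ltnS.
by case: (leqP (p x) (p ord0)); case: (leqP (p y) (p ord0)) => /=; lia.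
Qed.

(** A peak of the inverse would give letters [v], [v.+1], [v.+2] whose positions
    go up and then down.  A letter with a smaller one to its left is high, so
    [v.+1] is high; then [v.+2] is high as well and stands further right. *)
Lemma realizes_ipk0 w p : realizes w p -> ipk p == 0.
Proof.
move=> p_w; apply/ipk0P => i lt_in.
have lt_in1 := ltnW lt_in; have lt_in0 := ltnW lt_in1.
rewrite !nth_oneline !ltnS.
set x := (p^-1)%g _; set y := (p^-1)%g _; set z := (p^-1)%g _.
have : p x < p y by rewrite !permKV.
have : p y < p z by rewrite !permKV.
rewrite !p_w /precedes.
by case: (low w x) (low w y) (low w z) => [] [] [] //=; lia.
Qed.

(** Entry [i] of [w] describes position [i.+1] of [p], the upper end of the step
    considered here. *)
Lemma realizes_ascent w p i : realizes w p -> i < n ->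
  (nth 0 (oneline p) i < nth 0 (oneline p) i.+1) = ~~ nth true w i.
Proof.
move=> p_w lt_in; have lt_in1 : i < n.+1 by apply: ltnW.
rewrite !nth_oneline ltnS p_w /precedes /= [low w i.+1]/low /=.
by case: nth; rewrite ?ltnSn ?orbT // ltnNge leqnSn andbF.
Qed.

Lemma realizes_avoids w p k : realizes w p ->
  avoids_consecutive p (1%g : 'S_k.+1) = ~~ infix (nseq k false) w.
Proof.
move=> p_w; congr (~~ _).
apply/contains_identityP/(infix_nseqP true) => -[i le_in asc]; exists i.
- by rewrite size_tuple; lia.
- by move=> j lt_j; apply/negbTE; rewrite -(realizes_ascent p_w) ?asc; lia.
- by move: le_in; rewrite size_tuple; lia.
- move: le_in; rewrite size_tuple => le_in j le_ij lt_j.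
  by rewrite (realizes_ascent p_w) ?asc //; lia.
Qed.

End Word.

(** * Boolean words without long runs of [false] *)

Lemma card_tuple_bool n (P : pred (seq bool)) :
  #|[set w : n.+1.-tuple bool | P w]|
  = #|[set w : n.-tuple bool | P (true :: w)]|
    + #|[set w : n.-tuple bool | P (false :: w)]|.
Proof.
rewrite -!sum1dep_card.
rewrite (reindex (fun u : bool * n.-tuple bool => [tuple of u.1 :: u.2])) /=.
  rewrite -(@pair_big_dep _ _ _ _ _ xpredT
    (fun b (w : n.-tuple bool) => P (b :: w)) (fun _ _ => 1)) /=.
  by rewrite big_bool.
exists (fun w : n.+1.-tuple bool => (thead w, [tuple of behead w]))
  => [[b w]|w] _ /=.
  by congr pair; apply: val_inj.
by rewrite [RHS]tuple_eta.
Qed.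

(** Fibonacci numbers satisfy a recurrence with [k] terms; allowing only [t]
    letters [false] before the first [true] truncates it to [t.+1] terms, one
    for each possible length of this initial run, and makes the induction peel
    off one letter at a time.  A leading [true] resets the allowance to
    [k.-1], a leading [false] lowers it by one. *)
Lemma card_words_slack k n t : t < k ->
  #|[set w : n.-tuple bool |
       ~~ prefix (nseq t.+1 false) w && ~~ infix (nseq k false) w]|
  = sumn (take t.+1 (kfib_rev k n)).
Proof.
case: k => // k; rewrite ltnS; elim: n t => [|n IHn] t le_tk.
  rewrite /= addn0 -[RHS](card_tuple 0 bool) -[in RHS]cardsT.
  by apply: eq_card => w; rewrite !inE tuple0.
rewrite (card_tuple_bool n (fun w =>
  ~~ prefix (nseq t.+1 false) w && ~~ infix (nseq k.+1 false) w)).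
have true_head : [set w : n.-tuple bool |
    ~~ prefix (nseq t.+1 false) (true :: w)
      && ~~ infix (nseq k.+1 false) (true :: w)]
  = [set w : n.-tuple bool |
    ~~ prefix (nseq k.+1 false) w && ~~ infix (nseq k.+1 false) w].
  apply/setP => w; rewrite !inE infix_consl /=.
  by symmetry; apply/andb_idl/contra/prefixW.
rewrite {}true_head IHn //=; congr (_ + _).
case: t le_tk => [|t] lt_tk.
  by rewrite take0 /=; apply: eq_card0 => w; rewrite !inE /= prefix0s.
rewrite -IHn 1?ltnW //; apply: eq_card => w; rewrite !inE.
rewrite negb_or andbA; congr (_ && _).
(* The lowered allowance [t] is below [k]; it already excludes the run of [k.+1]
   letters that uses the leading one. *)
apply/andb_idr; apply: contra; apply: prefix_trans.
by rewrite -(subnKC lt_tk) nseqD; apply: prefix_prefix.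
Qed.

Lemma card_words k n : 0 < k ->
  #|[set w : n.-tuple bool | ~~ infix (nseq k false) w]| = kfib k n.+1.
Proof.
case: k => // k _; rewrite /kfib /= -card_words_slack //.
apply: eq_card => w; rewrite !inE; symmetry; apply/andb_idl.
exact/contra/prefixW.
Qed.

Theorem theorem1 (n m : nat) (hn : 1 <= n) (hm : 3 <= m) :
  #|[set p : 'S_n | avoids_consecutive p (1%g : 'S_m) && (ipk p == 0)]|
    = kfib (m - 1) n.
Proof.
case: n hn => // n _; case: m hm => [//|k] lt2k; rewrite subn1 /=.
rewrite -card_words; last by lia.
rewrite -(card_in_imset (f := @word n)); last first.
  move=> p q; rewrite !inE.
  move=> /andP[_ /ipk0_realizes p_w] /andP[_ /ipk0_realizes q_w].
  by move=> eq_w; apply: (realizes_inj p_w); rewrite eq_w.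
apply: eq_card => w; rewrite inE; apply/imsetP/idP => [[p] | avoid_w].
  rewrite inE => /andP[avoid_p /ipk0_realizes p_w] ->.
  by rewrite -(realizes_avoids k p_w).
have [p p_w] := realizable n.+1 w; exists p; last by rewrite (word_realizes p_w).
by rewrite inE (realizes_avoids k p_w) avoid_w (realizes_ipk0 p_w).
Qed.
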